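(* Let $1,2,3$ be distinct vertices and let $s$ be a graph with no edge containing the vertex $1$. Then: (1) $s\wedge 12\wedge 123\;\sim\; s\wedge 23$; (2) $s\wedge 12\wedge 13\wedge 123\;\sim\;(s\wedge 2)\cup(s\wedge 3)$; (3) $s\wedge 12\wedge 123^2\;\sim\; s\wedge 2$; (4) if $s\wedge 2\wedge 23$ is totally satisfiable then $s\wedge 12^2\wedge 123$ is totally satisfiable, and if $s\wedge 12^2\wedge 123$ is totally satisfiable then $s\wedge 2$ is totally satisfiable. Here juxtaposed vertices denote the edge on those vertices (e.g. $2=\{2\}$, $12=\{1,2\}$, $123=\{1,2,3\}$), and a superscript denotes the multiplicity of the edge (so $12^2$ is the edge $\{1,2\}$ with multiplicity $2$); no superscript means multiplicity one.
   Context: Each vertex $v$ is also a boolean variable. A clause is a disjunction of literals; a Cnf is a conjunction of one or more clauses, viewed as a set of clauses; a Cnf is satisfiable if some truth assignment makes it true. An edge is a nonempty set of vertices; a graph is a nonempty multiset of edges, written $(e_1)^{n_1}\cdots(e_m)^{n_m}$ with $n_i$ the multiplicity of $e_i$. The edge $v_1\cdots v_k$ supports the $2^k$ clauses $l_1\vee\cdots\vee l_k$ with $l_i\in\{v_i,\overline{v_i}\}$. The edge $e$ with multiplicity $n$ corresponds to the set of all Cnfs $c_1\wedge\cdots\wedge c_n$ with $c_1,\dots,c_n$ pairwise distinct clauses supported on $e$. A graph $(e_1)^{n_1}\cdots(e_m)^{n_m}$ is identified with the set of all Cnfs $x_1\wedge\cdots\wedge x_m$ with $x_i$ in the set corresponding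 to $e_i$ with multiplicity $n_i$. For sets of Cnfs, $s_1\wedge s_2=\{x_1\wedge x_2: x_1\in s_1,x_2\in s_2\}$, and $\cup$ is set union. A set of Cnfs is totally satisfiable if it is nonempty and every Cnf in it is satisfiable; otherwise it is unsatisfiable. $s_1\sim s_2$ (equi-satisfiable) means both are totally satisfiable or both are unsatisfiable. *)

(* Defs.v *)
From HB Require Import structures.
From mathcomp Require Import all_boot finmap multiset.
From mathcomp Require Import boolp classical_sets.

Set Implicit Arguments.
Unset Strict Implicit.
Unset Printing Implicit Defensive.

Local Open Scope fset_scope.

(* [(v, true)] is the literal v and [(v, false)] its negation. *)
Definition literal (V : choiceType) : choiceType := (V * bool)%type.

Definition clause (V : choiceType) : choiceType := {fset literal V}.

Record cnf (V : choiceType) := Cnf {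
  clauses : {fset clause V};
  clauses_neq0 : clauses != fset0 }.

Definition satisfies (V : choiceType) (t : V -> bool) (x : cnf V) : Prop :=
  forall c, c \in clauses x -> exists2 l : literal V, l \in c & t l.1 = l.2.

Definition satisfiable (V : choiceType) (x : cnf V) : Prop :=
  exists t : V -> bool, satisfies t x.

(* The value of the multiset at an edge is the multiplicity of that edge. *)
Record graph (V : choiceType) := Graph {
  edges : {mset {fset V}}%mset;
  edges_neq0 : edges != mset0;
  edge_neq0 : fset0 \notin edges }.

Definition supports (V : choiceType) (e : {fset V}) (c : clause V) : Prop :=
  exists b : V -> bool, c = [fset (v, b v) | v in e].

(* Empty when [n] exceeds the number 2 ^ #|e| of clauses supported on [e]. *)
Definition edge_cnfs (V : choiceType) (e : {fset V}) (n : nat) :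
    set (cnf V) :=
  [set x | exists cs : seq (clause V),
    [/\ size cs = n, uniq cs, (forall c, c \in cs -> supports e c)
      & clauses x = [fset c in cs]]]%classic.

(* A Cnf being a set of clauses, a conjunction of Cnfs is a union. *)
Definition graph_cnfs (V : choiceType) (s : graph V) : set (cnf V) :=
  [set x | exists y : {fset V} -> cnf V,
    (forall e, e \in edges s -> edge_cnfs e (edges s e) (y e)) /\
    clauses x = (\bigcup_(e <- finsupp (edges s)) clauses (y e))%fset]%classic.

Definition cnfs_and (V : choiceType) (A B : set (cnf V)) : set (cnf V) :=
  [set x | exists x1 x2 : cnf V,
    [/\ A x1, B x2 & clauses x = (clauses x1 `|` clauses x2)%fset]]%classic.

Notation "A /&\ B" := (cnfs_and A B) (at level 50, left associativity).

Definition totally_satisfiable (V : choiceType) (A : set (cnf V)) : Prop :=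
  (A !=set0)%classic /\ forall x, A x -> satisfiable x.

Definition unsatisfiable (V : choiceType) (A : set (cnf V)) : Prop :=
  ~ totally_satisfiable A.

Definition equisatisfiable (V : choiceType) (A B : set (cnf V)) : Prop :=
  (totally_satisfiable A /\ totally_satisfiable B) \/
  (unsatisfiable A /\ unsatisfiable B).

(* Main.v *)
Require Import Defs.
From mathcomp Require Import all_boot finmap multiset.
From mathcomp Require Import boolp classical_sets.

Set Implicit Arguments.
Unset Strict Implicit.
Unset Printing Implicit Defensive.

Local Open Scope fset_scope.

(** Eliminating the variable [v1] is propositional resolution.  A choice of
    Cnf from an edge is a choice of polarities [b], and an assignment [t]
    satisfies the clause of [e] with polarities [b] exactly when [t] and [b]
    agree at some vertex of [e].  Total satisfiability of a conjunction
    therefore unfolds, edge by edge, into a statement about [graph_cnfs s]: for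
    every Cnf [x] of [s] and every choice of polarities there is an assignment
    satisfying [x] that meets each chosen clause ([satisfiable_within_edge1],
    [satisfiable_within_edge2]).

    No clause of [x] mentions [v1], so any assignment satisfying [x] may be
    changed at [v1] ([graph_cnfs_update]).  To pass to the side containing
    [v1], one takes an assignment meeting a suitable clause on [v2] and [v3] and
    then picks the value at [v1] that the remaining clauses call for.  In the
    other direction, one picks the polarities of the clauses containing [v1] so
    that together they entail the required clause on [v2] and [v3]; for
    instance [v1 \/ l] and [~ v1 \/ l] entail [l].  The lemmas [eliminate_*]
    carry this out, one for each pattern of clauses containing [v1]; the first
    half of the last part also uses that dropping an edge preserves total
    satisfiability ([totally_satisfiable_andl]). *)

(** * Clauses as choices of polarities *)

Definition polarized_clause (V : choiceType) (e : {fset V}) (b : V -> bool) :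
    clause V :=
  [fset (v, b v) | v in e].

Definition agree_on (V : choiceType) (e : {fset V}) (b t : V -> bool) : Prop :=
  exists2 v, v \in e & t v = b v.

Lemma polarized_clauseP (V : choiceType) (e : {fset V}) (b t : V -> bool) :
  (exists2 l : literal V, l \in polarized_clause e b & t l.1 = l.2) <->
  agree_on e b t.
Proof.
split=> [[l /imfsetP[v /= ve ->] /= tv]|[v ve tv]]; first by exists v.
by exists (v, b v) => //; apply: in_imfset.
Qed.

Lemma polarized_clause_neq (V : choiceType) (e : {fset V}) (b b' : V -> bool) :
  polarized_clause e b != polarized_clause e b' <->
  exists2 v, v \in e & b v != b' v.
Proof.
split=> [neq|[v ve neq]]; last first.
  apply: contra neq => /eqP eqc.
  have: (v, b v) \in polarized_clause e b by apply: in_imfset.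
  by rewrite eqc => /imfsetP[w /= _ [-> ->]].
apply: contrapT => same; case/eqP: neq.
apply: eq_in_imfset => // v /= ve; congr pair.
by apply/eqP/negPn/negP => neq; apply: same; exists v.
Qed.

Lemma agree_on1 (V : choiceType) (v : V) (b t : V -> bool) :
  agree_on [fset v] b t <-> t v = b v.
Proof.
split=> [[w]|tv]; first by rewrite inE => /eqP->.
by exists v => //; rewrite inE.
Qed.

Lemma agree_on2 (V : choiceType) (v w : V) (b t : V -> bool) :
  agree_on [fset v; w] b t <-> t v = b v \/ t w = b w.
Proof.
split=> [[u]|[tv|tw]].
- by rewrite !inE => /orP[]/eqP->; [left|right].
- by exists v => //; rewrite !inE eqxx.
- by exists w => //; rewrite !inE eqxx orbT.
Qed.

Lemma agree_on3 (V : choiceType) (u v w : V) (b t : V -> bool) :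
  agree_on [fset u; v; w] b t <-> [\/ t u = b u, t v = b v | t w = b w].
Proof.
split=> [[z]|[tu|tv|tw]].
- by rewrite !inE -orbA => /or3P[]/eqP->;
    [constructor 1|constructor 2|constructor 3].
- by exists u => //; rewrite !inE eqxx.
- by exists v => //; rewrite !inE eqxx orbT.
- by exists w => //; rewrite !inE eqxx !orbT.
Qed.

Lemma edge_cnfs1P (V : choiceType) (e : {fset V}) (x : cnf V) :
  edge_cnfs e 1 x <-> exists b, clauses x = [fset polarized_clause e b].
Proof.
split=> [[cs [+ _ supp ->]]|[b xE]].
  case: cs supp => [|c []] //= supp _; have [b cE] := supp c (mem_head _ _).
  by exists b; apply/fsetP => d; rewrite !inE orbF cE.
exists [:: polarized_clause e b]; split=> // [c|].
  by rewrite inE => /eqP->; exists b.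
by rewrite xE; apply/fsetP => d; rewrite !inE orbF.
Qed.

Lemma edge_cnfs2P (V : choiceType) (e : {fset V}) (x : cnf V) :
  edge_cnfs e 2 x <-> exists b b', (exists2 v, v \in e & b v != b' v) /\
    clauses x = [fset polarized_clause e b; polarized_clause e b'].
Proof.
split=> [[cs [+ + supp ->]]|[b [b' [/polarized_clause_neq neq xE]]]].
  case: cs supp => [|c [|c' []]] //= supp _; rewrite inE andbT => neq.
  have [b cE] : exists b, c = polarized_clause e b
    by apply: supp; rewrite !inE eqxx.
  have [b' c'E] : exists b, c' = polarized_clause e b
    by apply: supp; rewrite !inE eqxx orbT.
  exists b, b'; split; first by apply/polarized_clause_neq; rewrite -cE -c'E.
  by apply/fsetP => d; rewrite !inE orbF cE c'E.
exists [:: polarized_clause e b; polarized_clause e b']; split=> //=.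
- by rewrite inE andbT.
- by move=> c; rewrite !inE => /orP[]/eqP->; [exists b|exists b'].
- by rewrite xE; apply/fsetP => d; rewrite !inE orbF.
Qed.

Lemma satisfies_edge1 (V : choiceType) (e : {fset V}) (b t : V -> bool)
    (x : cnf V) :
  clauses x = [fset polarized_clause e b] ->
  satisfies t x <-> agree_on e b t.
Proof.
rewrite /satisfies => ->; rewrite -polarized_clauseP; split=> [|sat c].
  by apply; rewrite inE.
by rewrite inE => /eqP->.
Qed.

Lemma satisfies_edge2 (V : choiceType) (e : {fset V}) (b b' t : V -> bool)
    (x : cnf V) :
  clauses x = [fset polarized_clause e b; polarized_clause e b'] ->
  satisfies t x <-> agree_on e b t /\ agree_on e b' t.
Proof.
rewrite /satisfies => ->; rewrite -!polarized_clauseP; split=> [sat|[sb sb'] c].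
  by split; apply: sat; rewrite !inE eqxx ?orbT.
by rewrite !inE => /orP[]/eqP->.
Qed.

Lemma cnf_of_mem (V : choiceType) (C : {fset clause V}) (c : clause V) :
  c \in C -> exists x : cnf V, clauses x = C.
Proof.
move=> cC; have C0 : C != fset0 by apply/fset0Pn; exists c.
by exists (Cnf C0).
Qed.

Lemma edge_cnfs2_neq0 (V : choiceType) (e : {fset V}) (b b' : V -> bool) :
  (exists2 v, v \in e & b v != b' v) ->
  exists2 x, edge_cnfs e 2 x &
    clauses x = [fset polarized_clause e b; polarized_clause e b'].
Proof.
move=> neq; have [x xE] := cnf_of_mem
  (fset21 (polarized_clause e b) (polarized_clause e b')).
by exists x => //; apply/edge_cnfs2P; exists b, b'.
Qed.

Lemma edge_cnfs1_neq0 (V : choiceType) (e : {fset V}) (b : V -> bool) :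
  exists2 x, edge_cnfs e 1 x & clauses x = [fset polarized_clause e b].
Proof.
have [x xE] := cnf_of_mem (fset11 (polarized_clause e b)).
by exists x => //; apply/edge_cnfs1P; exists b.
Qed.

(** * Unfolding total satisfiability of a conjunction *)

Lemma satisfies_and (V : choiceType) (t : V -> bool) (x y z : cnf V) :
  clauses z = (clauses x `|` clauses y)%fset ->
  satisfies t z <-> satisfies t x /\ satisfies t y.
Proof.
rewrite /satisfies => ->; split=> [sat|[sx sy] c].
  by split=> c cx; apply: sat; rewrite inE cx ?orbT.
by rewrite inE => /orP[/sx|/sy].
Qed.

Lemma cnfs_andI (V : choiceType) (A B : set (cnf V)) (x y : cnf V) :
  A x -> B y ->
  exists2 z, (A /&\ B) z & clauses z = (clauses x `|` clauses y)%fset.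
Proof.
move=> Ax By; have /fset0Pn[c cx] := clauses_neq0 x.
have [|z zE] := @cnf_of_mem _ (clauses x `|` clauses y)%fset c.
  by rewrite inE cx.
by exists z => //; exists x, y.
Qed.

(** The side condition [P] accumulates the clauses already split off from a
    conjunction; see [satisfiable_within_edge1]. *)
Definition satisfiable_within (V : choiceType) (A : set (cnf V))
    (P : (V -> bool) -> Prop) : Prop :=
  (A !=set0)%classic /\ forall x, A x -> exists2 t, satisfies t x & P t.

Lemma totally_satisfiableE (V : choiceType) (A : set (cnf V)) :
  totally_satisfiable A <-> satisfiable_within A (fun=> True).
Proof. by split=> -[A0 sat]; split=> // x /sat[t]; exists t. Qed.

Lemma satisfiable_within_edge1 (V : choiceType) (A : set (cnf V))
    (e : {fset V}) (P : (V -> bool) -> Prop) :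
  satisfiable_within (A /&\ edge_cnfs e 1) P <->
  forall b, satisfiable_within A (fun t => agree_on e b t /\ P t).
Proof.
split=> [[[_ [x0 [_ [Ax0 _ _]]]] sat] b|sat].
  split=> [|x Ax]; first by exists x0.
  have [y ey yE] := edge_cnfs1_neq0 e b.
  have [z Az zE] := cnfs_andI Ax ey; have [t + Pt] := sat z Az.
  move=> /(satisfies_and _ zE)[tx /(satisfies_edge1 _ yE) ty].
  by exists t.
split=> [|z [x [y [Ax /edge_cnfs1P[b yE] zE]]]].
  have [[x Ax] _] := sat xpredT; have [y ey _] := edge_cnfs1_neq0 e xpredT.
  by have [z] := cnfs_andI Ax ey; exists z.
have [_ /(_ x Ax)[t tx [tb Pt]]] := sat b; exists t => //.
by apply/(satisfies_and _ zE); split=> //; apply/satisfies_edge1/tb.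
Qed.

Lemma satisfiable_within_edge2 (V : choiceType) (A : set (cnf V))
    (e : {fset V}) (P : (V -> bool) -> Prop) :
  e != fset0 ->
  satisfiable_within (A /&\ edge_cnfs e 2) P <->
  forall b b', (exists2 v, v \in e & b v != b' v) ->
    satisfiable_within A
      (fun t => (agree_on e b t /\ agree_on e b' t) /\ P t).
Proof.
move=> /fset0Pn[v0 v0e].
split=> [[[_ [x0 [_ [Ax0 _ _]]]] sat] b b' neq|sat].
  split=> [|x Ax]; first by exists x0.
  have [y ey yE] := edge_cnfs2_neq0 neq.
  have [z Az zE] := cnfs_andI Ax ey; have [t + Pt] := sat z Az.
  move=> /(satisfies_and _ zE)[tx].
  by move=> /(satisfies_edge2 _ yE) ty; exists t.
split=> [|z [x [y [Ax /edge_cnfs2P[b [b' [neq yE]]] zE]]]].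
  have neq : exists2 v, v \in e & xpredT v != xpred0 v by exists v0.
  have [[x Ax] _] := sat _ _ neq; have [y ey _] := edge_cnfs2_neq0 neq.
  by have [z] := cnfs_andI Ax ey; exists z.
have [_ /(_ x Ax)[t tx [tb Pt]]] := sat _ _ neq; exists t => //.
by apply/(satisfies_and _ zE); split=> //; apply/satisfies_edge2/tb.
Qed.

Lemma totally_satisfiable_edge1 (V : choiceType) (A : set (cnf V))
    (e : {fset V}) :
  totally_satisfiable (A /&\ edge_cnfs e 1) <->
  forall b, satisfiable_within A (agree_on e b).
Proof.
rewrite totally_satisfiableE satisfiable_within_edge1.
split=> sat b; have [A0 {}sat] := sat b; split=> // x /sat[t tx].
  by case; exists t.
by exists t.
Qed.

(** The empty set is not totally satisfiable, yet adds nothing to a union; hence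
    the hypothesis that both sets are empty or neither is. *)
Lemma totally_satisfiableU (V : choiceType) (A B : set (cnf V)) :
  ((A !=set0)%classic <-> (B !=set0)%classic) ->
  totally_satisfiable (A `|` B)%classic <->
  totally_satisfiable A /\ totally_satisfiable B.
Proof.
move=> AB; split=> [[AB0 sat]|[[[x Ax] satA] [_ satB]]].
  have A0 : (A !=set0)%classic.
    by case: AB0 => x [Ax|Bx]; [|apply/AB]; exists x.
  split; split; [by []|by move=> x ?; apply: sat; left|exact/AB|].
  by move=> x ?; apply: sat; right.
by split=> [|y [/satA|/satB]] //; exists x; left.
Qed.

Lemma cnfs_and_edge1_neq0 (V : choiceType) (A : set (cnf V)) (e : {fset V}) :
  (A /&\ edge_cnfs e 1 !=set0)%classic <-> (A !=set0)%classic.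
Proof.
split=> [[_ [x [_ [Ax _ _]]]]|[x Ax]]; first by exists x.
have [y ey _] := edge_cnfs1_neq0 e xpredT.
by have [z] := cnfs_andI Ax ey; exists z.
Qed.

Lemma equisatisfiable_iff (V : choiceType) (A B : set (cnf V)) :
  (totally_satisfiable A <-> totally_satisfiable B) -> equisatisfiable A B.
Proof.
move=> AB; case: (EM (totally_satisfiable A)) => satA; [left|right].
  by split=> //; apply/AB.
by split=> // /AB.
Qed.

(** * Eliminating a vertex by resolution *)

Definition ignores (V : choiceType) (v : V) (A : set (cnf V)) : Prop :=
  forall x t a, A x -> satisfies t x -> satisfies [eta t with v |-> a] x.

Lemma graph_cnfs_update (V : choiceType) (v : V) (s : graph V) :
  (forall e : {fset V}, e \in edges s -> v \notin e) ->
  ignores v (graph_cnfs s).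
Proof.
move=> vs x t a [y [ye xE]] tx c cx; have [l lc tl] := tx c cx; exists l => //=.
move: cx; rewrite xE => /bigfcupP[e /andP[es _] ce].
have {}es : e \in edges s by rewrite -msuppE.
have [cs [_ _ supp yE]] := ye e es.
have [|b cE] := supp c; first by move: ce; rewrite yE inE.
move: lc; rewrite cE => /imfsetP[w /= we lE].
case: eqP => // lv; move: (vs e es).
by rewrite -lv lE we.
Qed.

(** From the right, an assignment meeting the resolvent [v2 = b v2 \/ v3 = c v3]
    leaves at most one of the two clauses to be met at [v1].  From the left,
    [v1 \/ v2 = b v2] and [~ v1 \/ v2 = b v2 \/ v3 = b v3] have the given clause
    as resolvent. *)
Lemma eliminate_12_123 (V : choiceType) (v1 v2 v3 : V) (A : set (cnf V)) :
  v2 != v1 -> v3 != v1 -> v3 != v2 -> ignores v1 A ->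
  totally_satisfiable (A /&\ edge_cnfs [fset v1; v2] 1
                         /&\ edge_cnfs [fset v1; v2; v3] 1) <->
  totally_satisfiable (A /&\ edge_cnfs [fset v2; v3] 1).
Proof.
move=> n21 n31 n32 A1; rewrite !totally_satisfiable_edge1; split=> sat.
  move=> b; have /satisfiable_within_edge1 := sat [eta b with v1 |-> false].
  move=> /(_ [eta b with v1 |-> true])[A0 {}sat].
  split=> // x /sat[t tx [p q]]; exists t => //; move: p q.
  rewrite agree_on2 agree_on3 /= eqxx (negPf n21) (negPf n31) agree_on2.
  by case=> [->|]; [case=> // ->|]; [left|right|left].
move=> c; apply/satisfiable_within_edge1 => b.
have [A0 {}sat] := sat [eta c with v2 |-> b v2]; split=> // x Ax.
have [t tx] := sat x Ax; rewrite agree_on2 /= eqxx (negPf n32) => tbc.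
exists [eta t with v1 |-> if t v2 == b v2 then c v1 else b v1]; first exact: A1.
rewrite agree_on2 agree_on3 /= eqxx (negPf n21) (negPf n31).
have [t2|/eqP t2] := eqVneq; first by split; [right|constructor 1].
by case: tbc => // t3; split; [left|constructor 3].
Qed.

(** From the right, two of the three chosen values at [v1] coincide; that value
    at [v1] leaves a single clause, to be met at [v2] or at [v3].  From the
    left, the literal on [v2] is entailed by [v1 \/ v2 = b v2],
    [~ v1 \/ v3 = b v3] and [~ v1 \/ v2 = b v2 \/ v3 <> b v3]; the literal on
    [v3] is symmetric. *)
Lemma eliminate_12_13_123 (V : choiceType) (v1 v2 v3 : V) (A : set (cnf V)) :
  v2 != v1 -> v3 != v1 -> v3 != v2 -> ignores v1 A ->
  totally_satisfiable (A /&\ edge_cnfs [fset v1; v2] 1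
                         /&\ edge_cnfs [fset v1; v3] 1
                         /&\ edge_cnfs [fset v1; v2; v3] 1) <->
  totally_satisfiable (A /&\ edge_cnfs [fset v2] 1) /\
  totally_satisfiable (A /&\ edge_cnfs [fset v3] 1).
Proof.
move=> n21 n31 n32 A1; rewrite !totally_satisfiable_edge1; split=> [sat|].
  split=> b.
    have := sat [eta b with v1 |-> false, v3 |-> ~~ b v3].
    move=> /satisfiable_within_edge1/(_ [eta b with v1 |-> false]).
    move=> /satisfiable_within_edge1/(_ [eta b with v1 |-> true])[A0 {}sat].
    split=> // x /sat[t tx [p [q r]]]; exists t => //; move: p q r.
    rewrite !agree_on2 agree_on3 agree_on1 /= !eqxx.
    rewrite (negPf n21) (negPf n31) eq_sym (negPf n32).
    by case=> // -> [] // -> [] //; case: (b v3).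
  have := sat [eta b with v1 |-> false, v2 |-> ~~ b v2].
  move=> /satisfiable_within_edge1/(_ [eta b with v1 |-> true]).
  move=> /satisfiable_within_edge1/(_ [eta b with v1 |-> false])[A0 {}sat].
  split=> // x /sat[t tx [p [q r]]]; exists t => //; move: q p r.
  rewrite !agree_on2 agree_on3 agree_on1 /= !eqxx.
  rewrite (negPf n21) (negPf n31) (negPf n32).
  by case=> // -> [] // -> [] //; case: (b v2).
move=> [sat2 sat3] d; apply/satisfiable_within_edge1 => c.
apply/satisfiable_within_edge1 => b.
split=> [|x Ax]; first by case: (sat2 b).
have [d1|/eqP dNc] := eqVneq (d v1) (c v1).
  have [_ /(_ x Ax)[t tx /agree_on1 t2]] := sat2 b.
  exists [eta t with v1 |-> c v1]; first exact: A1.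
  rewrite !agree_on2 agree_on3 /= eqxx (negPf n21) (negPf n31).
  by split; [right|split; [left|constructor 1]].
have [d1|/eqP dNb] := eqVneq (d v1) (b v1).
  have [_ /(_ x Ax)[t tx /agree_on1 t3]] := sat3 c.
  exists [eta t with v1 |-> b v1]; first exact: A1.
  rewrite !agree_on2 agree_on3 /= eqxx (negPf n21) (negPf n31).
  by split; [left|split; [right|constructor 1]].
have bc : b v1 = c v1 by case: (b v1) (c v1) (d v1) dNc dNb => [] [] [].
have [_ /(_ x Ax)[t tx /agree_on1 t2]] := sat2 d.
exists [eta t with v1 |-> b v1]; first exact: A1.
rewrite !agree_on2 agree_on3 /= eqxx (negPf n21) (negPf n31).
by split; [left|split; [left|constructor 2]].
Qed.

(** From the right, either the two clauses on [v1], [v2], [v3] have the same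
    polarity at [v1], or one of them has the polarity of the clause on [v1],
    [v2]; in both cases one value at [v1] leaves a single clause, to be met at
    [v2].  From the left, [v1 \/ v2 = b v2], [~ v1 \/ v2 = b v2 \/ v3] and
    [~ v1 \/ v2 = b v2 \/ ~ v3] entail the literal on [v2]. *)
Lemma eliminate_12_123_123 (V : choiceType) (v1 v2 v3 : V) (A : set (cnf V)) :
  v2 != v1 -> v3 != v1 -> v3 != v2 -> ignores v1 A ->
  totally_satisfiable (A /&\ edge_cnfs [fset v1; v2] 1
                         /&\ edge_cnfs [fset v1; v2; v3] 2) <->
  totally_satisfiable (A /&\ edge_cnfs [fset v2] 1).
Proof.
move=> n21 n31 n32 A1; rewrite totally_satisfiable_edge1 totally_satisfiableE.
rewrite satisfiable_within_edge2; last first.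
  by apply/fset0Pn; exists v1; rewrite !inE eqxx.
split=> sat.
  move=> b; have := sat [eta b with v1 |-> false, v3 |-> true]
    [eta b with v1 |-> false, v3 |-> false].
  case/(_ _)/satisfiable_within_edge1/(_ [eta b with v1 |-> true]).
    by exists v3; rewrite /= ?(negPf n31) ?eqxx // !inE eqxx !orbT.
  move=> A0 {}sat; split=> // x /sat[t tx [p [[q r] _]]].
  exists t => //; move: p q r.
  rewrite agree_on2 !agree_on3 agree_on1 /= !eqxx.
  rewrite (negPf n21) (negPf n31) ![v2 == v3]eq_sym (negPf n32).
  by case=> // -> [] // -> [].
move=> c c' _; apply/satisfiable_within_edge1 => b.
split=> [|x Ax]; first by case: (sat b).
have [b1|/eqP c'Nb] := eqVneq (c' v1) (b v1).
  have [_ /(_ x Ax)[t tx /agree_on1 t2]] := sat c.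
  exists [eta t with v1 |-> b v1]; first exact: A1.
  rewrite agree_on2 !agree_on3 /= eqxx (negPf n21) (negPf n31).
  by split; [left|split=> //; split; [constructor 2|constructor 1]].
have [b1|/eqP cNb] := eqVneq (c v1) (b v1).
  have [_ /(_ x Ax)[t tx /agree_on1 t2]] := sat c'.
  exists [eta t with v1 |-> b v1]; first exact: A1.
  rewrite agree_on2 !agree_on3 /= eqxx (negPf n21) (negPf n31).
  by split; [left|split=> //; split; [constructor 1|constructor 2]].
have cc' : c v1 = c' v1 by case: (b v1) (c v1) (c' v1) c'Nb cNb => [] [] [].
have [_ /(_ x Ax)[t tx /agree_on1 t2]] := sat b.
exists [eta t with v1 |-> c v1]; first exact: A1.
rewrite agree_on2 !agree_on3 /= eqxx (negPf n21) (negPf n31).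
by split; [right|split=> //; split; constructor 1].
Qed.

(** From the right, if the two clauses on [v1], [v2] have the same polarity at
    [v1], that value meets both and leaves the third clause, to be met at [v2].
    Otherwise one of them has the polarity of the third clause at [v1]; that
    value meets these two and leaves the other, again to be met at [v2].  From
    the left, [v1 \/ v2 = b v2] and [~ v1 \/ v2 = b v2] entail the literal on
    [v2]. *)
Lemma eliminate_12_12_123 (V : choiceType) (v1 v2 v3 : V) (A : set (cnf V)) :
  v2 != v1 -> v3 != v1 -> ignores v1 A ->
  totally_satisfiable (A /&\ edge_cnfs [fset v1; v2] 2
                         /&\ edge_cnfs [fset v1; v2; v3] 1) <->
  totally_satisfiable (A /&\ edge_cnfs [fset v2] 1).
Proof.
move=> n21 n31 A1; rewrite !totally_satisfiable_edge1.
have e0 : [fset v1; v2] != fset0.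
  by apply/fset0Pn; exists v1; rewrite !inE eqxx.
split=> sat.
  move=> b; have /(satisfiable_within_edge2 _ _ e0) := sat b.
  move=> /(_ [eta b with v1 |-> true] [eta b with v1 |-> false]) [].
    by exists v1; rewrite /= ?eqxx // !inE eqxx.
  move=> A0 {}sat; split=> // x /sat[t tx [[p q] _]].
  exists t => //; move: p q.
  rewrite !agree_on2 agree_on1 /= eqxx (negPf n21).
  by case=> // -> [].
move=> d; apply/(satisfiable_within_edge2 _ _ e0) => b b' _.
split=> [|x Ax]; first by case: (sat b).
have [b1|/eqP bNb'] := eqVneq (b v1) (b' v1).
  have [_ /(_ x Ax)[t tx /agree_on1 t2]] := sat d.
  exists [eta t with v1 |-> b v1]; first exact: A1.
  rewrite !agree_on2 agree_on3 /= eqxx (negPf n21) (negPf n31).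
  by split; [split; left|constructor 2].
have [d1|/eqP dNb] := eqVneq (d v1) (b v1).
  have [_ /(_ x Ax)[t tx /agree_on1 t2]] := sat b'.
  exists [eta t with v1 |-> d v1]; first exact: A1.
  rewrite !agree_on2 agree_on3 /= eqxx (negPf n21) (negPf n31).
  by split; [split; [left|right]|constructor 1].
have d1 : d v1 = b' v1 by case: (b v1) (b' v1) (d v1) bNb' dNb => [] [] [].
have [_ /(_ x Ax)[t tx /agree_on1 t2]] := sat b.
exists [eta t with v1 |-> d v1]; first exact: A1.
rewrite !agree_on2 agree_on3 /= eqxx (negPf n21) (negPf n31).
by split; [split; [right|left]|constructor 1].
Qed.

Lemma totally_satisfiable_andl (V : choiceType) (A : set (cnf V))
    (e : {fset V}) :
  totally_satisfiable (A /&\ edge_cnfs e 1) -> totally_satisfiable A.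
Proof.
move/totally_satisfiable_edge1/(_ xpredT) => [A0 sat].
by split=> // x /sat[t tx _]; exists t.
Qed.

Theorem mainTheorem8 (V : choiceType) (v1 v2 v3 : V) (s : graph V)
    (h12 : v1 != v2) (h13 : v1 != v3) (h23 : v2 != v3)
    (hs : forall e : {fset V}, e \in edges s -> v1 \notin e) :
  [/\ equisatisfiable
        (graph_cnfs s /&\ edge_cnfs [fset v1; v2] 1
                      /&\ edge_cnfs [fset v1; v2; v3] 1)
        (graph_cnfs s /&\ edge_cnfs [fset v2; v3] 1),
      equisatisfiable
        (graph_cnfs s /&\ edge_cnfs [fset v1; v2] 1
                      /&\ edge_cnfs [fset v1; v3] 1
                      /&\ edge_cnfs [fset v1; v2; v3] 1)
        ((graph_cnfs s /&\ edge_cnfs [fset v2] 1) `|`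
         (graph_cnfs s /&\ edge_cnfs [fset v3] 1))%classic,
      equisatisfiable
        (graph_cnfs s /&\ edge_cnfs [fset v1; v2] 1
                      /&\ edge_cnfs [fset v1; v2; v3] 2)
        (graph_cnfs s /&\ edge_cnfs [fset v2] 1)
    & (totally_satisfiable
         (graph_cnfs s /&\ edge_cnfs [fset v2] 1
                       /&\ edge_cnfs [fset v2; v3] 1) ->
       totally_satisfiable
         (graph_cnfs s /&\ edge_cnfs [fset v1; v2] 2
                       /&\ edge_cnfs [fset v1; v2; v3] 1)) /\
      (totally_satisfiable
         (graph_cnfs s /&\ edge_cnfs [fset v1; v2] 2
                       /&\ edge_cnfs [fset v1; v2; v3] 1) ->
       totally_satisfiable
         (graph_cnfs s /&\ edge_cnfs [fset v2] 1))].
Proof.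
have n21 : v2 != v1 by rewrite eq_sym.
have n31 : v3 != v1 by rewrite eq_sym.
have n32 : v3 != v2 by rewrite eq_sym.
have A1 := graph_cnfs_update hs.
split; [| | |split].
- exact/equisatisfiable_iff/eliminate_12_123.
- apply/equisatisfiable_iff.
  rewrite eliminate_12_13_123 // totally_satisfiableU //.
  by rewrite !cnfs_and_edge1_neq0.
- exact/equisatisfiable_iff/eliminate_12_123_123.
- by move/totally_satisfiable_andl => sat; apply/eliminate_12_12_123.
- by move/eliminate_12_12_123; apply.
Qed.
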